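(* For integers $K\ge0$ and $\nu\ge1$ let \[ \widetilde H_K(\nu):=\sum_{K\ge k_1>\cdots>k_\nu\ge1}\frac{1}{(2k_1+1)^2\cdots(2k_\nu+1)^2} \] (an empty sum, e.g. when $\nu>K$, being $0$), and $\widetilde H_K(0):=1$. Then for any integer $\mu\ge0$, \[ \big(1-4^{-\mu-1}\big)\zeta(2\mu+2)=1+\sum_{k=1}^\infty\frac{(-1)^{k+\mu-1}}{16^k(2k+1)^2}\binom{2k}{k}\Big(\frac{10k^3+9k^2-k+1}{2k-1}\widetilde H_{k-1}(\mu)+4k(k+1)\sum_{j=1}^{\mu}\frac{(-1)^j}{(2k+1)^{2j}}\widetilde H_{k-1}(\mu-j)\Big). \]
   Context: $\zeta$ is the Riemann zeta function. *)

(* Defs.v *)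
From HB Require Import structures.
From mathcomp Require Import all_boot all_order all_algebra.
From mathcomp Require Import all_classical all_reals all_analysis.
Set Implicit Arguments.
Unset Strict Implicit.
Unset Printing Implicit Defensive.
Import Order.TTheory GRing.Theory Num.Theory.
Import numFieldNormedType.Exports.
Local Open Scope classical_set_scope.
Local Open Scope ring_scope.

(* The Riemann zeta function on the real half-line s > 1, where it is given
   by its Dirichlet series; for s <= 1 the series diverges and the value is
   meaningless. *)
Definition zeta (R : realType) (s : R) : R := limn (series (riemannR s)).

(* An index tuple K >= k_1 > ... > k_nu >= 1 is a strictly decreasing tuple of
   elements of {0, ..., K}, all of them positive. For nu = 0 the only tuple is
   the empty one, whose (empty) product is 1, so that Htilde R K 0 = 1. *)
Definition Htilde (R : realType) (K nu : nat) : R :=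
  \sum_(k : nu.-tuple 'I_K.+1 |
          sorted gtn (map val k) && all (fun i : 'I_K.+1 => (0 < i)%N) k)
    \prod_(i < nu) (((2 * tnth k i + 1)%:R : R) ^+ 2)^-1.

(* Main.v *)
Require Import Defs.
From HB Require Import structures.
From mathcomp Require Import all_boot all_order all_algebra.
From mathcomp Require Import all_classical all_reals all_analysis.
From mathcomp Require Import ring lra zify.
Import Order.TTheory GRing.Theory Num.Theory.
Import numFieldNormedType.Exports.
Local Open Scope classical_set_scope.
Local Open Scope ring_scope.

(* Write a_j = (2j+1)^2 and let y be a formal variable recording mu, so that
   (-1)^mu Htilde K mu is the coefficient of y^mu in
   P_K(y) = prod_(j = 1..K) (1 - y / a_j). For N = 2n+1, telescoping the ratios
   P_K(y) / P_K(N^2) over K < n gives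

     1 / (N^2 - y) = P_(n-1)(y) / (P_(n-1)(N^2) (N^2 - y))
                     - sum_(k = 1..n-1) P_(k-1)(y) / (a_k P_k(N^2)).

   Since N^2 - a_j = 4 (n - j) (n + j + 1), summing the last terms over n > k
   is a Gosper-summable problem with an explicit antidifference; together with
   the first term at n = k it produces the k-th term of the accelerated series.
   Summing over n <= M leaves the antidifferences at M + 1, whose total is
   O(1/M), so both the convergence and the value follow from
   sum_n (2n+1)^(-2mu-2) = (1 - 4^(-mu-1)) zeta(2mu+2). *)

(** * Nested sums over decreasing tuples as a recursion *)

Lemma big_cons_tuple (R : Type) (idx : R) (op : Monoid.com_law idx)
    (I : finType) (n : nat) (P : pred (n.+1.-tuple I))
    (F : n.+1.-tuple I -> R) :
  \big[op/idx]_(t | P t) F t =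
  \big[op/idx]_(x : I) \big[op/idx]_(t : n.-tuple I | P (cons_tuple x t))
     F (cons_tuple x t).
Proof.
rewrite pair_big_dep /=.
rewrite (reindex (fun p : I * n.-tuple I => cons_tuple p.1 p.2)) //=.
exists (fun t : n.+1.-tuple I => (thead t, behead_tuple t)).
  by move=> [x t] _ /=; congr pair; apply/val_inj.
by move=> t _ /=; rewrite [t in RHS]tuple_eta.
Qed.

Lemma sorted_gtn_cons (x K : nat) (s : seq nat) :
  sorted gtn (x :: s) && all (fun i => 0 < i <= K)%N (x :: s) =
  (0 < x <= K)%N && (sorted gtn s && all (fun i => 0 < i <= x.-1)%N s).
Proof.
rewrite /= path_sortedE; last by move=> a b c; rewrite /gtn /=; lia.
case Hx: (0 < x <= K)%N; rewrite /= ?andbF //.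
rewrite andbAC -all_predI [RHS]andbC; congr andb.
by apply: eq_all => i /=; rewrite /gtn /=; lia.
Qed.

(** Here [x] is the largest index k_1; peeling it off opens identities and bounds to induction. *)
Fixpoint oddH (R : realType) (K nu : nat) : R :=
  if nu is nu'.+1
  then \sum_(1 <= x < K.+1) ((2 * x + 1)%:R ^+ 2)^-1 * oddH R x.-1 nu'
  else 1.

(** The index type ['I_B] stays fixed while the bound [K] shrinks to [x.-1] in the induction on
    [nu]. *)
Lemma sum_bounded_tuple (R : realType) (B K nu : nat) : (K < B)%N ->
  \sum_(k : nu.-tuple 'I_B |
          sorted gtn (map val k) && all (fun i => 0 < i <= K)%N (map val k))
    \prod_(i < nu) (((2 * tnth k i + 1)%:R : R) ^+ 2)^-1 = oddH R K nu.
Proof.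
elim: nu K => [|nu IH] K KB.
  rewrite (big_pred1 [tuple]) ?big_ord0 // => t /=.
  by rewrite (tuple0 t) /= eqxx.
rewrite big_cons_tuple /= (big_nat_widen 1 K.+1 B) // (big_nat_widenl 1 0) //.
rewrite big_mkord [RHS]big_mkcond /=; apply: eq_bigr => x _.
rewrite (eq_bigl (fun t : nu.-tuple 'I_B => (0 < x <= K)%N &&
  (sorted gtn (map val t) && all (fun i => 0 < i <= x.-1)%N (map val t))));
  last by move=> t; exact: (sorted_gtn_cons x K (map val t)).
rewrite ltnS andbC; case: ifP => [/andP[x0 xK]|_]; last by rewrite big_pred0.
rewrite -(IH x.-1) ?mulr_sumr; last by lia.
apply: eq_bigr => t _; rewrite big_ord_recl tnth0; congr (_ * _).
by apply: eq_bigr => i _; rewrite tnthS.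
Qed.

Lemma HtildeE (R : realType) (K nu : nat) : Htilde R K nu = oddH R K nu.
Proof.
rewrite -(@sum_bounded_tuple R K.+1) // /Htilde; apply: eq_bigl => t.
congr andb; rewrite all_map; apply: eq_all => i /=.
by have := ltn_ord i; rewrite ltnS => ->; rewrite andbT.
Qed.

Lemma oddHS (R : realType) (K nu : nat) :
  oddH R K.+1 nu.+1 =
  oddH R K nu.+1 + ((2 * K.+1 + 1)%:R ^+ 2)^-1 * oddH R K nu.
Proof. by rewrite /= big_nat_recr. Qed.

Lemma oddH_ge0 (R : realType) (K nu : nat) : 0 <= oddH R K nu.
Proof.
elim: nu K => [|nu IH] K /=; first exact: ler01.
by apply: sumr_ge0 => x _; rewrite mulr_ge0 // invr_ge0 exprn_ge0.
Qed.

Lemma oddH_le1 (R : realType) (K nu : nat) : oddH R K nu <= 1.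
Proof.
elim: nu K => [|nu IH] K //.
(* Strengthened for induction on [K]: the new factor 1/(2K+3)^2 is at most 1/((K+1)(K+2)) = 1/(K+1)
   - 1/(K+2). *)
suff: oddH R K nu.+1 <= 1 - (K.+1%:R)^-1.
  by move=> /le_trans; apply; rewrite gerBl invr_ge0.
elim: K => [|K IHK]; first by rewrite /= big_geq // invr1 subrr.
rewrite oddHS; set v := (_ ^+ 2)^-1.
have v0 : 0 <= v by rewrite invr_ge0 exprn_ge0.
have : v * oddH R K nu <= v by rewrite ler_piMr.
suff : v <= (K.+1%:R)^-1 - (K.+2%:R)^-1.
  move: IHK; move: (K.+1%:R^-1) (K.+2%:R^-1) (oddH _ _ _) (v * _).
  by move=> ? ? ? ? ? ? ?; lra.
have -> : (K.+1%:R)^-1 - (K.+2%:R)^-1 = (K.+1%:R * K.+2%:R)^-1 :> R.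
  by rewrite -!natr1; have k0 := ler0n R K; field; apply/andP; split; lra.
rewrite /v lef_pV2 ?posrE ?mulr_gt0 ?exprn_gt0 ?ltr0n ?addn1 //.
by rewrite -natrX -natrM ler_nat; nia.
Qed.

(** * Coefficients of the generating polynomials *)

Section AcceleratedSeries.
Variable R : realType.
Implicit Types (x t : R) (K m n k i : nat).

(* The coefficient of y^m in prod_(j = 1..K) (1 - y / (2j+1)^2). *)
Definition signedH K m : R := (-1) ^+ m * oddH R K m.

Lemma signedH0 K : signedH K 0 = 1.
Proof. by rewrite /signedH expr0 mul1r. Qed.

Lemma signedH0S m : signedH 0 m.+1 = 0.
Proof. by rewrite /signedH /= big_geq // mulr0. Qed.

Lemma signedHS K m :
  signedH K.+1 m.+1 = signedH K m.+1 - signedH K m / (2 * K%:R + 3) ^+ 2.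
Proof.
rewrite /signedH oddHS exprS natrD natrM -(natr1 K).
have -> : 2 * (K%:R + 1) + 1 = 2 * K%:R + 3 :> R by ring.
by ring.
Qed.

Lemma signedH_norm_le1 K m : `|signedH K m| <= 1.
Proof.
by rewrite normrM normrX normrN1 expr1n mul1r ger0_norm ?oddH_ge0 ?oddH_le1.
Qed.

(* The coefficient of y^m in prod_(j = 1..K) (1 - y / (2j+1)^2) / (x - y). *)
Fixpoint quotH x K m : R :=
  if m is m'.+1 then (signedH K m + quotH x K m') / x else x^-1.

Lemma quotH0 x m : quotH x 0 m = x ^- m.+1.
Proof.
elim: m => [|m IH] //=.
by rewrite signedH0S add0r IH [in RHS]exprS invfM mulrC.
Qed.

(** With a = (2K+3)^2, write 1 - y/a = (1 - x/a) + (x - y)/a and divide by x - y. *)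
Lemma quotHS x K m : x != 0 ->
  quotH x K.+1 m = quotH x K m * (1 - x / (2 * K%:R + 3) ^+ 2)
                   + signedH K m / (2 * K%:R + 3) ^+ 2.
Proof.
move=> x0; have a0 : 2 * K%:R + 3 != 0 :> R.
  by rewrite lt0r_neq0 //; have := ler0n R K; lra.
elim: m => [|m IH] /=; first by rewrite signedH0; field; rewrite a0.
by rewrite signedHS IH; field; rewrite a0.
Qed.

(** Expanding t^2/(t^2 - y) as a geometric series turns the inner sum over j of the theorem into
    [quotH]; the subtracted [signedH] is the absent j = 0 term. *)
Lemma quotH_sum t K m : t != 0 ->
  (-1) ^+ m *
    (\sum_(1 <= j < m.+1) (-1) ^+ j / t ^+ (2 * j) * oddH R K (m - j)) =
  t ^+ 2 * quotH (t ^+ 2) K m - signedH K m.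
Proof.
move=> t0; elim: m => [|m IH].
  by rewrite big_geq //= signedH0 mulfV ?expf_neq0 // mulr0 subrr.
have -> : \sum_(1 <= j < m.+2) (-1) ^+ j / t ^+ (2 * j) * oddH R K (m.+1 - j) =
  - t ^- 2 * (oddH R K m +
    \sum_(1 <= j < m.+1) (-1) ^+ j / t ^+ (2 * j) * oddH R K (m - j)).
  rewrite big_nat_recl // subn1 /= muln1 mulrDr mulr_sumr; congr (_ + _).
    by rewrite expr1 mulN1r.
  apply: eq_bigr => j _; rewrite subSS mulnS exprS exprD; field.
  by rewrite t0 expf_neq0.
rewrite exprS mulN1r !mulNr mulrN opprK mulrCA mulrDr IH /= {1}/signedH.
by field.
Qed.

(** * Weights and Gosper-summable tails *)

(* Equal to ((2i+1)!!)^2 / 4^(i+1). *)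
Definition weight i : R :=
  ((2 * i).+2)`!%:R ^+ 2 / (16 ^+ i.+1 * (i.+1)`!%:R ^+ 2).

Lemma factR_neq0 n : n`!%:R != 0 :> R.
Proof. by rewrite pnatr_eq0 -lt0n fact_gt0. Qed.

Lemma weightS i : weight i.+1 = weight i * (2 * i%:R + 3) ^+ 2 / 4.
Proof.
rewrite /weight mulnS !add2n !factS !natrM (exprS _ i.+1).
have : 16 ^+ i.+1 != 0 :> R by rewrite expf_neq0 // pnatr_eq0.
move: (16 ^+ i.+1) (ler0n R i) => q i0 q0; field.
by rewrite factR_neq0 q0 !lt0r_neq0 //; lra.
Qed.

(* [Hsummand k n] is 1 / prod_(j = 1..k) (n - j) (n + j + 1), and [Htail k n]
   is its sum over all indices from [n] on, found by Gosper summation; both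
   presuppose k < n. *)
Definition Hsummand k n : R :=
  n%:R * (n%:R + 1) * (n - k.+1)`!%:R / (n + k.+1)`!%:R.

Definition Htail k n : R :=
  (n - k.+1)`!%:R / (n + k)`!%:R *
  ((n%:R - k%:R) * (n%:R + k%:R) / (2 * k%:R - 1)
   + k%:R * (k%:R + 1) / (2 * k%:R + 1)).

Lemma Hsummand0 n : (0 < n)%N -> Hsummand 0 n = 1.
Proof.
case: n => // n _; rewrite /Hsummand subn1 addn1 /= !factS !natrM.
have n0 := ler0n R n; field.
by rewrite factR_neq0 !lt0r_neq0 //; lra.
Qed.

Lemma HsummandS k n : (k.+1 < n)%N ->
  Hsummand k n = Hsummand k.+1 n * (n%:R - k%:R - 1) * (n%:R + k%:R + 2).
Proof.
move=> kn; have [r ->] : exists r, n = (k + r).+2 by exists (n - k.+2)%N; lia.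
rewrite /Hsummand.
have -> : ((k + r).+2 - k.+1 = r.+1)%N by lia.
have -> : ((k + r).+2 - k.+2 = r)%N by lia.
rewrite !addnS !addSn !factS !natrM.
have k0 := ler0n R k; have r0 := ler0n R r.
field.
by rewrite factR_neq0 !lt0r_neq0 //; lra.
Qed.

Lemma Htail_diff k n : (0 < k < n)%N ->
  Htail k n - Htail k n.+1 = Hsummand k n.
Proof.
move=> /andP[k1 kn].
have [r ->] : exists r, n = (k + r).+1 by exists (n - k.+1)%N; lia.
rewrite /Hsummand /Htail.
have -> : ((k + r).+1 - k.+1 = r)%N by lia.
have -> : ((k + r).+2 - k.+1 = r.+1)%N by lia.
rewrite !addnS !addSn !factS !natrM.
have k0 : 1 <= k%:R :> R by rewrite ler1n.
have r0 := ler0n R r.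
field.
by rewrite factR_neq0 !lt0r_neq0 //; lra.
Qed.

Lemma Htail_ge0 k n : (0 < k < n)%N -> 0 <= Htail k n.
Proof.
move=> /andP[k1 kn].
have k0 : 1 <= k%:R :> R by rewrite ler1n.
have n0 : k%:R <= n%:R :> R by rewrite ler_nat ltnW.
rewrite /Htail mulr_ge0 ?divr_ge0 //; apply: addr_ge0.
  by rewrite divr_ge0 ?mulr_ge0 //; lra.
by rewrite divr_ge0 ?mulr_ge0 //; lra.
Qed.

(** [Htail k n] has order n^(1-2k), so at most 1/n for k >= 1; monotonicity makes this explicit,
    with the value at n = k + 1 as constant. *)
Lemma Htail_decr k n : (0 < k < n)%N ->
  n.+1%:R * Htail k n.+1 <= n%:R * Htail k n.
Proof.
move=> /andP[k1 kn].
have [r ->] : exists r, n = (k + r).+1 by exists (n - k.+1)%N; lia.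
rewrite /Htail.
have -> : ((k + r).+1 - k.+1 = r)%N by lia.
have -> : ((k + r).+2 - k.+1 = r.+1)%N by lia.
rewrite addSn !factS !natrM.
have k0 : 1 <= k%:R :> R by rewrite ler1n.
have r0 := ler0n R r.
rewrite -subr_ge0.
(* The difference factors into expressions visibly nonnegative for k >= 1; [f] and [g] abstract the
   factorial parts. *)
have D : forall f g : R, g != 0 ->
  (k + r).+1%:R * (f / g * (((k + r).+1%:R - k%:R) * ((k + r).+1%:R + k%:R) /
    (2 * k%:R - 1) + k%:R * (k%:R + 1) / (2 * k%:R + 1))) -
  (k + r).+2%:R * (r.+1%:R * f / ((k + r + k).+2%:R * g) *
    (((k + r).+2%:R - k%:R) * ((k + r).+2%:R + k%:R) / (2 * k%:R - 1) +
     k%:R * (k%:R + 1) / (2 * k%:R + 1))) =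
  f / g * ((2 * k%:R + 2 * r%:R + 3) / (2 * k%:R + r%:R + 2)) *
  ((r%:R + 1) * (2 * k%:R + r%:R + 2) * (k%:R - 1) / (2 * k%:R - 1)
   + k%:R ^+ 2 * (k%:R + 1) / (2 * k%:R + 1)).
  by move=> f g g0; field; rewrite g0 !lt0r_neq0 //; lra.
rewrite D ?mulf_neq0 ?factR_neq0 ?pnatr_eq0 //.
apply: mulr_ge0.
  by rewrite mulr_ge0 ?divr_ge0 ?mulr_ge0 //; lra.
by apply: addr_ge0; rewrite divr_ge0 ?mulr_ge0 ?exprn_ge0 //; lra.
Qed.

Lemma Htail_bound k n : (0 < k < n)%N ->
  n%:R * Htail k n <= k.+1%:R * Htail k k.+1.
Proof.
move=> /andP[k1 kn]; rewrite -(subnKC kn); elim: (n - k.+1)%N => [|r IH].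
  by rewrite addn0.
by apply: le_trans IH; rewrite addnS Htail_decr //; lia.
Qed.

(** * From the expansion of one odd power to the accelerated sum *)

Lemma quotH_expand n K m : (K < n)%N ->
  (2 * n%:R + 1) ^- (2 * m.+1) =
  4 * weight K * (-1) ^+ K * Hsummand K n * quotH ((2 * n%:R + 1) ^+ 2) K m
  + \sum_(i < K) weight i * (-1) ^+ i * signedH i m * Hsummand i.+1 n.
Proof.
elim: K => [|K IH] Kn.
  rewrite big_ord0 addr0 Hsummand0 // quotH0 -exprM /weight muln0.
  by rewrite !factS fact0 expr0 expr1 !mulr1 !muln1; field.
rewrite {}IH 1?ltnW // big_ord_recr /= addrA [in RHS]addrAC; congr (_ + _).
have n0 : 2 * n%:R + 1 != 0 :> R by rewrite lt0r_neq0 //; have := ler0n R n; lra.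
(* The factor 1 - (2n+1)^2/(2K+3)^2 equals -4(n-K-1)(n+K+2)/(2K+3)^2, which the changes in
   [Hsummand], [weight] and sign absorb. *)
rewrite quotHS ?expf_neq0 // HsummandS // weightS (exprS _ K).
have K0 := ler0n R K.
by field; rewrite lt0r_neq0 //; lra.
Qed.

Lemma weight_ge0 i : 0 <= weight i.
Proof. by rewrite divr_ge0 ?mulr_ge0 ?exprn_ge0. Qed.

(** The factorial is kept apart because it cancels against the denominators of [Hsummand] and
    [Htail] at their least arguments. *)
Lemma weight_bin i :
  weight i = 'C(2 * i.+1, i.+1)%:R / 16 ^+ i.+1 * (2 * i.+1)`!%:R.
Proof.
have E : (i.+1 + i.+1)`!%:R = 'C(i.+1 + i.+1, i.+1)%:R
    * ((i.+1)`!%:R * (i.+1)`!%:R) :> R.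
  by rewrite -!natrM -(bin_fact (leq_addr i.+1 i.+1)) addnK.
rewrite /weight (mul2n i.+1) -addnn (_ : (2 * i).+2 = i.+1 + i.+1)%N; last by lia.
have : 16 ^+ i.+1 != 0 :> R by rewrite expf_neq0 // pnatr_eq0.
rewrite expr2 {1}E.
move: (16 ^+ i.+1) (i.+1)`!%:R (factR_neq0 i.+1) => q f f0 q0.
by field; rewrite q0 f0.
Qed.

Lemma weight_Htail i :
  weight i * Htail i.+1 i.+2 = 'C(2 * i.+1, i.+1)%:R / 16 ^+ i.+1 *
    ((2 * i.+1%:R - 1)^-1 + i.+1%:R * (i.+1%:R + 1) / (2 * i.+1%:R + 1) ^+ 2).
Proof.
rewrite weight_bin -(mulrA (_ / _)); congr (_ * _).
rewrite /Htail subnn fact0 addSn addnn -mul2n factS natrM.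
have i0 := ler0n R i; field.
by rewrite factR_neq0 !lt0r_neq0 //; lra.
Qed.

Lemma weight_Hsummand i :
  weight i * Hsummand i i.+1 =
  'C(2 * i.+1, i.+1)%:R / 16 ^+ i.+1 * (i.+1%:R * (i.+1%:R + 1)).
Proof.
rewrite weight_bin -(mulrA (_ / _)); congr (_ * _).
by rewrite /Hsummand subnn fact0 addnn -mul2n mulr1 mulrC divfK ?factR_neq0 //.
Qed.

Definition accel_term m k : R :=
  (-1) ^+ (k + m - 1) / (16 ^+ k * (2 * k%:R + 1) ^+ 2) * 'C(2 * k, k)%:R *
  ((10 * k%:R ^+ 3 + 9 * k%:R ^+ 2 - k%:R + 1) / (2 * k%:R - 1)
     * Htilde R (k - 1) m
   + 4 * k%:R * (k%:R + 1)
     * \sum_(1 <= j < m.+1)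
         (-1) ^+ j / (2 * k%:R + 1) ^+ (2 * j) * Htilde R (k - 1) (m - j)).

(** The first part is the leading term of [quotH_expand] at n = i + 1; the second collects the
    [i]-th summands over all n > i + 1. *)
Lemma accel_termS m i :
  accel_term m i.+1 =
  4 * weight i * (-1) ^+ i * Hsummand i i.+1
    * quotH ((2 * i.+1%:R + 1) ^+ 2) i m
  + weight i * (-1) ^+ i * signedH i m * Htail i.+1 i.+2.
Proof.
rewrite /accel_term addSn subn1 /= subn1 /= exprD HtildeE.
under eq_bigr => j _ do rewrite HtildeE.
have i0 := ler0n R i.
have t0 : 2 * i.+1%:R + 1 != 0 :> R.
  by rewrite lt0r_neq0 //; have := ler0n R i.+1; lra.
have := @quotH_sum (2 * i.+1%:R + 1) i m t0.
set S := \sum_(_ <= _ < _) _ => ES.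
transitivity ((-1) ^+ i * ('C(2 * i.+1, i.+1)%:R / 16 ^+ i.+1) *
  ((10 * i.+1%:R ^+ 3 + 9 * i.+1%:R ^+ 2 - i.+1%:R + 1) / (2 * i.+1%:R - 1)
    * signedH i m + 4 * i.+1%:R * (i.+1%:R + 1) * ((-1) ^+ m * S))
  / (2 * i.+1%:R + 1) ^+ 2).
  by rewrite /signedH invfM; ring.
rewrite ES.
transitivity (4 * (weight i * Hsummand i i.+1) * (-1) ^+ i
    * quotH ((2 * i.+1%:R + 1) ^+ 2) i m
  + (weight i * Htail i.+1 i.+2) * (-1) ^+ i * signedH i m); last by ring.
rewrite weight_Htail weight_Hsummand.
move: (_ / 16 ^+ _) (quotH _ _ _) => c q; field.
by rewrite !lt0r_neq0 //; lra.
Qed.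

(** The share of the first [M] accelerated terms that belongs to odd powers with n > M. *)
Definition remainder m M : R :=
  \sum_(i < M) weight i * (-1) ^+ i * signedH i m * Htail i.+1 M.+1.

(** By induction on [M]: raising [M] lowers each [Htail] by one [Hsummand], and these make up the
    sum in [quotH_expand] at n = M + 1, K = M. *)
Lemma odd_sum_accel m M :
  \sum_(n < M) (2 * n.+1%:R + 1) ^- (2 * m.+1) =
  \sum_(i < M) accel_term m i.+1 - remainder m M.
Proof.
rewrite /remainder; elim: M => [|M IH]; first by rewrite !big_ord0 subrr.
rewrite !big_ord_recr /= IH (@quotH_expand M.+1 M) // accel_termS.
have -> : \sum_(i < M) weight i * (-1) ^+ i * signedH i m * Htail i.+1 M.+2 =
  \sum_(i < M) weight i * (-1) ^+ i * signedH i m * Htail i.+1 M.+1 -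
  \sum_(i < M) weight i * (-1) ^+ i * signedH i m * Hsummand i.+1 M.+1.
  rewrite -sumrB; apply: eq_bigr => i _.
  by rewrite -mulrBr -Htail_diff ?ltnS ?ltn_ord // opprB addrC subrK.
by ring.
Qed.

(** * Bounding the remainder *)

Lemma bin_le_exp2 n k : ('C(n, k) <= 2 ^ n)%N.
Proof.
elim: n k => [|n IH] [|k] //; first by rewrite bin0 expn_gt0.
by rewrite binS expnS mul2n -addnn leq_add.
Qed.

(** With p = 2^(i+1), the binomial is at most p^2, 16^(i+1) is p^4, i + 2 is at most p and the
    bracket at most 2. *)
Lemma weight_Htail_le i :
  weight i * (i.+2%:R * Htail i.+1 i.+2) <= 2 / 2 ^+ i.+1.
Proof.
rewrite mulrCA weight_Htail.
have i0 := ler0n R i.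
have p0 : 0 < 2 ^+ i.+1 :> R by rewrite exprn_gt0.
have -> : 16 ^+ i.+1 = (2 ^+ i.+1) ^+ 4 :> R.
  by rewrite -exprM mulnC exprM; congr (_ ^+ _); ring.
have C_le : 'C(2 * i.+1, i.+1)%:R <= (2 ^+ i.+1) ^+ 2 :> R.
  by rewrite -exprM mulnC -natrX ler_nat bin_le_exp2.
have i_le : i.+2%:R <= 2 ^+ i.+1 :> R by rewrite -natrX ler_nat ltn_expl.
set X := (X in _ * (_ * X)).
have X_ge0 : 0 <= X.
  by rewrite addr_ge0 ?divr_ge0 ?invr_ge0 ?mulr_ge0 ?exprn_ge0 //; lra.
have X_le : X <= 2.
  rewrite -[2]/(1 + 1) lerD //.
    by rewrite invf_le1; lra.
  by rewrite ler_pdivrMr ?mul1r ?exprn_gt0 //; nra.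
move: (2 ^+ i.+1) p0 C_le i_le => p p0 C_le i_le.
have -> : 2 / p = p * (p ^+ 2 / p ^+ 4 * 2).
  by field; rewrite lt0r_neq0.
have p4 : 0 <= p ^- 4 by rewrite invr_ge0 exprn_ge0 // ltW.
apply: ler_pM => //; first by rewrite !mulr_ge0.
by apply: ler_pM; rewrite ?mulr_ge0 // ler_wpM2r.
Qed.

Lemma remainder_le m M : `|remainder m M| <= 2 / M.+1%:R.
Proof.
(* After multiplication by M + 1, [Htail_bound] bounds the [i]-th summand independently of [M],
   leaving this geometric sum. *)
have geom : \sum_(i < M) (2 / 2 ^+ i.+1) <= 2 :> R.
  suff -> : \sum_(i < M) (2 / 2 ^+ i.+1) = 2 - 2 / 2 ^+ M :> R.
    by rewrite gerBl divr_ge0 ?exprn_ge0.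
  elim: M => [|M IH]; first by rewrite big_ord0 expr0 divr1 subrr.
  rewrite big_ord_recr /= IH exprS.
  by field; rewrite expf_neq0.
rewrite ler_pdivlMr // (le_trans _ geom) // mulrC -[X in X * _]normr_nat -normrM.
rewrite /remainder mulr_sumr (le_trans (ler_norm_sum _ _ _)) // ler_sum // => i _.
apply: le_trans (weight_Htail_le i).
have iM : (0 < i.+1 < M.+1)%N by exact: ltn_ord.
have -> : M.+1%:R * (weight i * (-1) ^+ i * signedH i m * Htail i.+1 M.+1) =
  weight i * (M.+1%:R * Htail i.+1 M.+1) * ((-1) ^+ i * signedH i m) by ring.
rewrite normrM ger0_norm ?(weight_ge0, Htail_ge0, mulr_ge0) //.
rewrite normrMsign -[leRHS]mulr1; apply: ler_pM => //.
- by rewrite !(weight_ge0, Htail_ge0, mulr_ge0).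
- by apply: ler_wpM2l; [exact: weight_ge0 | exact: Htail_bound].
- exact: signedH_norm_le1.
Qed.

End AcceleratedSeries.

(** * The zeta value and its odd part *)

Lemma cvg_zeta (R : realType) (m : nat) :
  (\sum_(n < N) (n.+1%:R : R) ^- (2 * m.+1)) @[N --> \oo] -->
  zeta (2 * m%:R + 2 : R).
Proof.
have E : (fun N => \sum_(n < N) (n.+1%:R : R) ^- (2 * m.+1)) =
    series (riemannR (2 * m%:R + 2 : R)).
  apply/funext => N; rewrite /series /= big_mkord; apply: eq_bigr => n _.
  by rewrite /riemannR -natrM -natrD powR_mulrn // mulnS addnC.
rewrite E /zeta.
(* [zeta] is a [limn], and [cvgn] means convergence to that very limit. *)
suff : cvgn (series (riemannR (2 * m%:R + 2 : R))) by [].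
rewrite -E; apply: nondecreasing_is_cvgn.
  apply/nondecreasing_seqP => N; rewrite big_ord_recr /= lerDl.
  by rewrite invr_ge0 exprn_ge0.
exists 2 => _ [N _ <-].
(* Each power is compared with 1/((N+1)(N+2)), which telescopes. *)
suff : \sum_(n < N.+1) n.+1%:R ^- (2 * m.+1) <= 2 - (N.+1%:R)^-1 :> R.
  move=> le2; apply: (@le_trans _ _ (2 - (N.+1%:R)^-1)); last first.
    by rewrite gerBl invr_ge0.
  by apply: le_trans le2; rewrite big_ord_recr /= lerDl invr_ge0 exprn_ge0.
elim: N => [|N IH].
  by rewrite big_ord_recr big_ord0 /= expr1n invr1; lra.
rewrite big_ord_recr /=.
have N0 := ler0n R N.
have H : (N.+2%:R : R) ^- (2 * m.+1) <= (N.+1%:R * N.+2%:R)^-1.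
  rewrite lef_pV2 ?posrE ?exprn_gt0 ?mulr_gt0 //.
  apply: (@le_trans _ _ (N.+2%:R ^+ 2)).
    by rewrite expr2 ler_wpM2r // ler_nat.
  by rewrite ler_weXn2l ?ler1n // leq_pmulr.
have D : (N.+1%:R * N.+2%:R)^-1 = N.+1%:R^-1 - N.+2%:R^-1 :> R.
  by field; rewrite !lt0r_neq0 //; lra.
move: IH H; rewrite D.
move: (\sum_(_ < _) _) (_ ^- _) N.+1%:R^-1 N.+2%:R^-1 => ? ? ? ? ? ?.
by lra.
Qed.

Lemma cvg_odd_zeta (R : realType) (m : nat) :
  (\sum_(n < N) (2 * n%:R + 1 : R) ^- (2 * m.+1)) @[N --> \oo] -->
  (1 - 4 ^- (m + 1)) * zeta (2 * m%:R + 2 : R).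
Proof.
(* The odd terms up to 2N are all terms minus the even ones, and the latter carry the factor
   4^-(m+1). *)
have E : (fun N => \sum_(n < N) (2 * n%:R + 1 : R) ^- (2 * m.+1)) =
  (fun N => \sum_(n < 2 * N) (n.+1%:R : R) ^- (2 * m.+1)
            - 4 ^- (m + 1) * \sum_(n < N) (n.+1%:R : R) ^- (2 * m.+1)).
  apply/funext; elim=> [|N IH]; first by rewrite muln0 !big_ord0 mulr0 subrr.
  rewrite (mulnS 2 N) !add2n !big_ord_recr /= IH.
  have -> : (2 * N).+2%:R = 2 * N.+1%:R :> R by ring.
  have -> : (2 * N).+1%:R = 2 * N%:R + 1 :> R by ring.
  rewrite exprMn invfM (exprM 2 2) addn1 (_ : 2 ^+ 2 = 4) ?expr2; last by ring.
  by ring.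
rewrite E mulrBl mul1r; apply: cvgB; last by apply: cvgMr; exact: cvg_zeta.
apply: (cvg_comp (muln 2) _ _ (@cvg_zeta R m)).
exact: cvg_mulnl.
Qed.

Theorem theorem6p1 (R : realType) (mu : nat) :
  let term (k : nat) : R :=
    (-1) ^+ (k + mu - 1) / (16 ^+ k * (2 * k%:R + 1) ^+ 2) * 'C(2 * k, k)%:R *
    ((10 * k%:R ^+ 3 + 9 * k%:R ^+ 2 - k%:R + 1) / (2 * k%:R - 1)
       * Htilde R (k - 1) mu
     + 4 * k%:R * (k%:R + 1)
       * \sum_(1 <= j < mu.+1)
           (-1) ^+ j / (2 * k%:R + 1) ^+ (2 * j) * Htilde R (k - 1) (mu - j)) in
  cvgn (fun n : nat => \sum_(1 <= k < n) term k) /\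
  (1 - 4 ^- (mu + 1)) * zeta (2 * mu%:R + 2 : R) = 1 + \big[+%R/0]_(1 <= k <oo) term k.
Proof.
move=> term; set L := (1 - _) * _.
suff lim_term : (fun n => \sum_(1 <= k < n) term k) @ \oo --> L - 1.
  split; first by apply/cvg_ex; exists (L - 1).
  by rewrite (cvg_lim _ lim_term) // addrC subrK.
rewrite -cvg_shiftS /=.
(* The odd sum starts at i = 0 with the term 1, which [odd_sum_accel] leaves out; hence the -1. *)
have -> : (fun n => \sum_(1 <= k < n.+1) term k) =
    (fun n => \sum_(i < n.+1) (2 * i%:R + 1) ^- (2 * mu.+1) - 1
              + remainder R mu n).
  apply/funext => n; rewrite big_ord_recl mulr0 add0r expr1n invr1 (addrC 1) addrK.
  rewrite (@odd_sum_accel R mu n) subrK.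
  by rewrite big_add1 big_mkord.
rewrite -[L - 1]addr0; apply: cvgD.
  apply: cvgB; last exact: cvg_cst.
  by have := @cvg_odd_zeta R mu; rewrite -cvg_shiftS.
apply: norm_cvg0.
apply: (@squeeze_cvgr _ _ _ _ (cst 0) (fun n => 2 * harmonic n)).
- by near=> n; rewrite normr_ge0 remainder_le.
- exact: cvg_cst.
- by rewrite -[0](mulr0 2); apply: cvgMr; exact: cvg_harmonic.
Unshelve. all: by end_near. Qed.
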